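(* Let $G$ be a graph and let $g,f:V(G)\rightarrow \mathbb{Z}^{+}$ be two integer-valued functions with $g(x)\leq f(x)$ for each $x\in V(G)$. Let $H$ be a subgraph of $G$. Then $G$ has all fractional $(g,f)$-factors excluding $H$ if and only if $$g(S)+\sum_{x\in T}d_{G-S}(x)-f(T)\geq\sum_{x\in T}d_H(x)-e_H(S,T)$$ for every subset $S$ of $V(G)$, where $T=\{x : x\in V(G)\setminus S,\ d_{G-S}(x)-d_H(x)+e_H(x,S)<f(x)\}$.
   Context: Graphs are finite, undirected, without loops or multiple edges. $\mathbb{Z}^{+}$ is the set of positive integers. $d_G(x)$ is the degree of $x$ in $G$; $G-S$ is the subgraph of $G$ induced by $V(G)\setminus S$. For a subgraph $H$ of $G$ and a vertex $x\in V(G)$, $d_H(x)$ is the number of edges of $H$ incident with $x$ (so it is $0$ if $x\notin V(H)$). For disjoint $S,T\subseteq V(G)$, $e_H(S,T)$ is the number of edges of $H$ with one end in $S$ and the other in $T$, and $e_H(x,S)=e_H(\{x\},S)$. For a function $\varphi$ on $V(G)$ and $X\subseteq V(G)$, $\varphi(X)=\sum_{x\in X}\varphi(x)$. For $r:V(G)\to\mathbb{Z}^{+}$, a function $h:E(G)\to[0,1]$ with $\sum_{e\in E(x)}h(e)=r(x)$ for every $x\in V(G)$, where $E(x)$ is the set of edges of $G$ incident with $x$, determines a fractional $r$-factor $F_h$ of $G$: the subgraph with vertex set $V(G)$ and edge set $E(F_h)=\{e\in E(G):h(e)>0\}$. $G$ has all fractional $(g,f)$-factors excluding $H$ if for every $r:V(G)\to\mathbb{Z}^{+}$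 with $g(x)\le r(x)\le f(x)$ for all $x\in V(G)$, $G$ has a fractional $r$-factor $F_h$ with $E(H)\cap E(F_h)=\emptyset$. *)

(* Defs.v *)
From HB Require Import structures.
From mathcomp Require Import all_boot all_order all_algebra reals.

Set Implicit Arguments.
Unset Strict Implicit.
Unset Printing Implicit Defensive.

Import Order.TTheory GRing.Theory Num.Theory.
Local Open Scope ring_scope.

(* An edge is its two-element set of ends, so loops and multiple edges
   cannot occur. *)
Record sgraph : Type := SGraph {
  vertex :> finType;
  edges : {set {set vertex}};
  edges_card2 : forall e : {set vertex}, e \in edges -> #|e| = 2%N }.

Record subgraph (G : sgraph) : Type := Subgraph {
  sub_vertices : {set G};
  sub_edges : {set {set G}};
  sub_edges_sub : sub_edges \subset edges G;
  sub_edges_ends :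
    forall e : {set G}, e \in sub_edges -> e \subset sub_vertices }.

Lemma del_edges_sub (G : sgraph) (S : {set G}) :
  [set e in edges G | e \subset ~: S] \subset edges G.
Proof. by apply/subsetP => e; rewrite inE => /andP[]. Qed.

Lemma del_edges_ends (G : sgraph) (S : {set G}) (e : {set G}) :
  e \in [set e in edges G | e \subset ~: S] -> e \subset ~: S.
Proof. by rewrite inE => /andP[]. Qed.

(* G - S. *)
Definition del (G : sgraph) (S : {set G}) : subgraph G :=
  Subgraph (del_edges_sub S) (@del_edges_ends G S).

Definition deg (G : sgraph) (H : subgraph G) (x : G) : nat :=
  #|[set e in sub_edges H | x \in e]|.

(* e_H(S, T); only used for disjoint S and T. *)
Definition ecount (G : sgraph) (H : subgraph G) (S T : {set G}) : nat :=
  #|[set e in sub_edges H |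
      [exists x in S, [exists y in T, e == [set x; y]]]]|.

(* h stands for a function on E(G): its values at sets that are not edges
   of G are never used. *)
Definition fractional_indicator (R : realType) (G : sgraph) (r : G -> nat)
    (h : {set G} -> R) : Prop :=
  (forall e : {set G}, e \in edges G -> 0 <= h e <= 1) /\
  (forall x : G, \sum_(e in edges G | x \in e) h e = (r x)%:R).

Lemma factor_edges_sub (R : realType) (G : sgraph) (h : {set G} -> R) :
  [set e in edges G | 0 < h e] \subset edges G.
Proof. by apply/subsetP => e; rewrite inE => /andP[]. Qed.

Lemma factor_edges_ends (R : realType) (G : sgraph) (h : {set G} -> R)
    (e : {set G}) : e \in [set e in edges G | 0 < h e] -> e \subset [set: G].
Proof. by move=> _; apply: subsetT. Qed.

(* F_h, determined by the indicator h. *)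
Definition factor (R : realType) (G : sgraph) (h : {set G} -> R) :
    subgraph G :=
  Subgraph (factor_edges_sub h) (@factor_edges_ends R G h).

Definition all_fractional_factors_excluding (R : realType) (G : sgraph)
    (g f : G -> nat) (H : subgraph G) : Prop :=
  forall r : G -> nat,
    (forall x : G, (0 < r x)%N) ->
    (forall x : G, (g x <= r x <= f x)%N) ->
    exists h : {set G} -> R,
      fractional_indicator r h /\
      sub_edges H :&: sub_edges (factor h) = set0.

(* The inequality is over int, so the subtraction is not truncated. *)
Definition Tset (G : sgraph) (f : G -> nat) (H : subgraph G) (S : {set G}) :
    {set G} :=
  [set x in ~: S | (deg (del S) x)%:Z - (deg H x)%:Z
                   + (ecount H [set x] S)%:Z < (f x)%:Z].

(* Main.v *)
(* The condition at S says that, in G' = G - E(H), the set T minimises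
   g(S) + sum_(x in T) (d_(G'-S)(x) - f(x)) over the sets disjoint from S. This is
   the extreme case (r = g on S, r = f on T) of the fractional r-factor condition
     r(T) <= r(S) + sum_(x in T) d_(G'-S)(x)   for disjoint S, T,
   which is necessary by double counting.  It is sufficient because it yields the
   cut condition for a bipartite r-factor of the double cover of G'. *)
Require Import Defs.
From mathcomp Require Import all_boot all_order all_algebra reals.
From mathcomp Require Import zify.

Import Order.TTheory GRing.Theory Num.Theory.
Local Open Scope ring_scope.

(** * Cuts of bipartite graphs and bipartite subgraphs with prescribed degrees *)

(** With every edge directed from [V] to [W], these are the arcs leaving the vertex set formed by
    [X] and [Y] together. *)
Definition cut {V W : finType} (E : {set V * W}) (X : {set V}) (Y : {set W}) :
  nat := #|[set p in E | (p.1 \in X) && (p.2 \notin Y)]|.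

Lemma cutE {V W : finType} (E : {set V * W}) X Y :
  cut E X Y = (\sum_(p in E) ((p.1 \in X) && (p.2 \notin Y)))%N.
Proof. by rewrite /cut -sum1dep_card big_mkcondr. Qed.

(** The inequality holds for each edge separately, by the four possible memberships of its two
    ends. *)
Lemma cut_submodular {V W : finType} (E : {set V * W}) X1 X2 Y1 Y2 :
  (cut E (X1 :|: X2) (Y1 :|: Y2) + cut E (X1 :&: X2) (Y1 :&: Y2)
   <= cut E X1 Y1 + cut E X2 Y2)%N.
Proof.
rewrite !cutE -!big_split /=; apply: leq_sum => p _; rewrite !inE.
by do 4! case: (_ \in _).
Qed.

Lemma cutD1 {V W : finType} (E : {set V * W}) X Y p : p \in E ->
  cut E X Y = ((p.1 \in X) && (p.2 \notin Y) + cut (E :\ p) X Y)%N.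
Proof. by move=> pE; rewrite !cutE (big_setD1 p). Qed.

Lemma sum_setUI {U : finType} (a : U -> int) (X1 X2 : {set U}) :
  \sum_(x in X1 :|: X2) a x + \sum_(x in X1 :&: X2) a x
  = \sum_(x in X1) a x + \sum_(x in X2) a x.
Proof.
rewrite 2!(big_mkcond (fun x => x \in _ _ _)) (big_mkcond (mem X1)).
rewrite (big_mkcond (mem X2)) -!big_split /=; apply: eq_bigr => x _; rewrite !inE.
by do 2! case: (_ \in _); rewrite //= addrC.
Qed.

Lemma sum_sub_delta {U : finType} (a : U -> int) u (X : {set U}) :
  \sum_(x in X) (a x - (x == u)%:Z) = \sum_(x in X) a x - (u \in X)%:Z.
Proof.
rewrite sumrB; congr (_ - _); case: (boolP (u \in X)) => uX.
  rewrite (big_setD1 u) //= eqxx big1 ?addr0 // => x.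
  by rewrite !inE => /andP[/negPf->].
by rewrite big1 // => x xX; case: eqP => // xu; rewrite -xu xX in uX.
Qed.

Lemma card_set_in_setU1 {U : finType} (A : {set U}) u (P : pred U) :
  u \notin A ->
  #|[set p in u |: A | P p]| = (P u + #|[set p in A | P p]|)%N.
Proof.
by move=> uA; rewrite -!sum1dep_card big_mkcondr big_setU1 // -big_mkcondr;
  case: (P u).
Qed.

(* An edge p of E can either be discarded or be put into A: if both choices
   violated the cut condition, the two violating pairs (X1, Y1) and (X2, Y2)
   would, by submodularity, have a violating union or intersection. *)
Lemma bipartite_factor {V W : finType} (E : {set V * W})
    (a : V -> int) (b : W -> int) :
  \sum_x a x = \sum_y b y ->
  (forall (X : {set V}) (Y : {set W}),
     \sum_(x in X) a x <= \sum_(y in Y) b y + (cut E X Y)%:Z) ->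
  exists2 A : {set V * W}, A \subset E &
    (forall x, #|[set p in A | p.1 == x]|%:Z = a x) /\
    (forall y, #|[set p in A | p.2 == y]|%:Z = b y).
Proof.
have [n] := ubnP #|E|; elim: n E a b => // n IHn E a b leEn sum_ab cutP.
have [E0|[p pE]] := set_0Vmem E.
  have c0 (X : {set V}) (Y : {set W}) : cut E X Y = 0%N by rewrite cutE E0 big_set0.
  (* Without edges, the cut condition at singletons gives [a <= 0 <= b], and the equal totals then
     force both to vanish. *)
  have a0 x : a x <= 0.
    by have := cutP [set x] set0; rewrite c0 big_set1 big_set0.
  have b0 y : 0 <= b y.
    by have := cutP set0 [set y]; rewrite c0 big_set1 big_set0 addr0.
  have sb : \sum_y b y = 0.
    by apply/le_anti; rewrite sumr_ge0 // -sum_ab sumr_le0.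
  have sa : \sum_x - a x = 0 by rewrite sumrN sum_ab sb oppr0.
  exists set0; first exact: sub0set.
  have card0 P : #|[set p in set0 : {set V * W} | P p]| = 0%N.
    by rewrite (_ : [set _ in _ | _] = set0) ?cards0 //;
       apply/setP=> p; rewrite !inE.
  split=> [x|y]; rewrite card0.
    by apply/esym/eqP; rewrite -oppr_eq0 (psumr_eq0P _ sa) // => i;
       rewrite oppr_ge0.
  by rewrite (psumr_eq0P _ sb).
have ltDn : (#|E :\ p| < n)%N by rewrite (cardsD1 p E) pE in leEn.
have pD : p \notin E :\ p by rewrite !inE eqxx.
case: (boolP [forall X : {set V}, forall Y : {set W},
    \sum_(x in X) a x <= \sum_(y in Y) b y + (cut (E :\ p) X Y)%:Z]).
  move=> /forallP dP; have {}dP X Y := forallP (dP X) Y.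
  have [A AD cA] := IHn _ _ _ ltDn sum_ab dP.
  by exists A => //; apply: subset_trans AD (subD1set _ _).
move=> noD; have [X1 [Y1 viol1]] : exists (X1 : {set V}) (Y1 : {set W}),
    \sum_(y in Y1) b y + (cut (E :\ p) X1 Y1)%:Z < \sum_(x in X1) a x.
  by case/forallPn: noD => X1 /forallPn[Y1]; rewrite -ltNge; exists X1, Y1.
(* Putting [p] into [A] uses up one unit of demand at each of its ends. *)
pose a' x := a x - (x == p.1)%:Z; pose b' y := b y - (y == p.2)%:Z.
have sum_ab' : \sum_x a' x = \sum_y b' y.
  have sum1 (U : finType) (u : U) : \sum_x (x == u)%:Z = 1.
    by rewrite (bigD1 u) //= eqxx big1 ?addr0 // => x /negPf->.
  by rewrite !sumrB sum_ab !sum1.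
have [A AD [cA1 cA2]] : exists2 A : {set V * W}, A \subset E :\ p &
    (forall x, #|[set p in A | p.1 == x]|%:Z = a' x) /\
    (forall y, #|[set p in A | p.2 == y]|%:Z = b' y).
  pose sa (X : {set V}) := \sum_(x in X) a x.
  pose sb (Y : {set W}) := \sum_(y in Y) b y.
  have {}cutP X Y : sa X <= sb Y
      + ((p.1 \in X) && (p.2 \notin Y) + cut (E :\ p) X Y)%N%:Z.
    by rewrite -cutD1 //; apply: cutP.
  apply: IHn => // X2 Y2; rewrite !sum_sub_delta -/(sa X2) -/(sb Y2).
  move: viol1; rewrite -/(sa X1) -/(sb Y1).
  have saUI : sa (X1 :|: X2) + sa (X1 :&: X2) = sa X1 + sa X2.
    exact: sum_setUI.
  have sbUI : sb (Y1 :|: Y2) + sb (Y1 :&: Y2) = sb Y1 + sb Y2.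
    exact: sum_setUI.
  (* Over the integers the violation at [(X1, Y1)] is by at least one unit. The condition for [E] at
     the union and the intersection, with submodularity, passes this unit to [(X2, Y2)], where it
     makes up for the lowered demands. *)
  have := cutP X2 Y2; have := cutP (X1 :|: X2) (Y1 :|: Y2).
  have := cutP (X1 :&: X2) (Y1 :&: Y2).
  have := cut_submodular (E :\ p) X1 X2 Y1 Y2.
  clear -saUI sbUI; rewrite !inE.
  by case: (p.1 \in X1) (p.1 \in X2) (p.2 \in Y1) (p.2 \in Y2);
    do 3! case; rewrite /=; lia.
have pA : p \notin A by apply: contra pD; apply: (subsetP AD).
exists (p |: A); first by rewrite subUset sub1set pE (subset_trans AD) ?subD1set.
by split=> z; rewrite card_set_in_setU1 // PoszD ?cA1 ?cA2 eq_sym addrC subrK.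
Qed.

(** * Neighbourhoods and double counting *)

(** A bare edge set as argument serves [edges G], [sub_edges H] and their difference alike. *)
Definition nbr {V : finType} (F : {set {set V}}) (x : V) : {set V} :=
  [set y | [set x; y] \in F].

Lemma nbr_sym {V : finType} (F : {set {set V}}) x y :
  (y \in nbr F x) = (x \in nbr F y).
Proof. by rewrite !inE setUC. Qed.

Lemma set2_inj {V : finType} (x : V) : injective (fun y => [set x; y]).
Proof.
move=> y z /setP yz; have := yz y; have := yz z; rewrite !inE !eqxx !orbT.
by case/orP=> /eqP-> // /esym/orP[]/eqP->.
Qed.

Lemma incident_imset {V : finType} (F : {set {set V}}) x :
  (forall e, e \in F -> #|e| = 2%N) ->
  [set e in F | x \in e] = [set [set x; y] | y in nbr F x].
Proof.
move=> F2; apply/setP => e; rewrite inE; apply/andP/imsetP => [[eF xe]|[y]].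
  have /eqP/cards2P[a [b [_ eab]]] := F2 e eF; subst e.
  case/set2P: xe eF => <- eF; first by exists b; rewrite ?inE.
  by exists a; rewrite ?inE setUC.
by rewrite inE => xyF ->; rewrite xyF set21.
Qed.

Lemma big_incident {V : finType} {R : Type} {idx : R}
    {op : Monoid.com_law idx} (F : {set {set V}}) (h : {set V} -> R) x :
  (forall e, e \in F -> #|e| = 2%N) ->
  \big[op/idx]_(e in F | x \in e) h e
  = \big[op/idx]_(y in nbr F x) h [set x; y].
Proof.
move=> F2; rewrite -(big_imset (h := fun y => [set x; y])) /=.
  by rewrite -incident_imset //; apply: eq_bigl => e; rewrite inE.
by move=> y z _ _; apply: set2_inj.
Qed.

Lemma card_incident {V : finType} (F : {set {set V}}) x :
  (forall e, e \in F -> #|e| = 2%N) -> #|[set e in F | x \in e]| = #|nbr F x|.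
Proof. by move=> F2; rewrite incident_imset // card_imset //; apply: set2_inj. Qed.

Lemma exchange_nbr {V : finType} {R : Type} {idx : R}
    {op : Monoid.com_law idx} (F : {set {set V}}) (S T : {set V})
    (h : {set V} -> R) :
  \big[op/idx]_(x in T) \big[op/idx]_(y in nbr F x :&: S) h [set x; y]
  = \big[op/idx]_(y in S) \big[op/idx]_(x in nbr F y :&: T) h [set y; x].
Proof.
rewrite (exchange_big_dep (mem S)) /= => [|x y _]; last by case/setIP.
apply: eq_bigr => y yS; apply: eq_big => [x|x _]; last by rewrite setUC.
by rewrite in_setI yS andbT andbC in_setI nbr_sym.
Qed.

Lemma exchange_card_nbr {V : finType} (F : {set {set V}}) (S T : {set V}) :
  (\sum_(x in T) #|nbr F x :&: S| = \sum_(y in S) #|nbr F y :&: T|)%N.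
Proof.
under eq_bigr do rewrite -sum1_card.
rewrite (exchange_nbr _ _ _ (fun=> 1%N)).
by apply: eq_bigr => y _; rewrite sum1_card.
Qed.

(** * Cuts of the double cover and half-integral factors *)

Lemma cut_nbr {V : finType} (F : {set {set V}}) (X Y : {set V}) :
  cut [set p | [set p.1; p.2] \in F] X Y
  = (\sum_(x in X) #|nbr F x :\: Y|)%N.
Proof.
under eq_bigr do rewrite -sum1_card.
rewrite pair_big_dep sum1_card /cut; apply: eq_card => p.
by rewrite [RHS]inE !inE andbCA [_ && (p.2 \notin Y)]andbC.
Qed.

(** Removing [X :&: Y] from both sets newly cuts only pairs from [X :\: Y] to [X :&: Y]. Their
    mirror images go from [X :&: Y] to a vertex outside [Y], so the old cut already counts them.
    Hence disjoint pairs suffice in the cut condition. *)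
Lemma cut_disjoint_le {V : finType} (F : {set {set V}}) (X Y : {set V}) :
  (\sum_(x in X :\: Y) #|nbr F x :\: (Y :\: X)|
   <= \sum_(x in X) #|nbr F x :\: Y|)%N.
Proof.
rewrite [leqRHS](big_setID Y) /= addnC.
apply: (@leq_trans (\sum_(x in X :\: Y)
                      (#|nbr F x :\: Y| + #|nbr F x :&: (X :&: Y)|))).
  apply: leq_sum => x _; apply: leq_trans (leq_card_setU _ _).
  apply/subset_leq_card/subsetP => y; rewrite !inE.
  by case: (y \in X) (y \in Y) => -[]; case: (_ \in F).
rewrite big_split leq_add2l /= exchange_card_nbr.
by apply: leq_sum => z _; apply/subset_leq_card; rewrite setIDA setSD ?subsetIl.
Qed.

Lemma sum_Posz {U : finType} (P : pred U) (r : U -> nat) :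
  \sum_(x | P x) (r x)%:Z = (\sum_(x | P x) r x)%N%:Z.
Proof. by rewrite (big_morph Posz PoszD (erefl _)). Qed.

(* The bipartite double cover of F has a subgraph A with all degrees r on both
   sides; averaging A with its mirror image gives a half-integral h. *)
Lemma fractional_factor (R : realType) {V : finType} (F : {set {set V}})
    (r : V -> nat) :
  (forall e, e \in F -> #|e| = 2%N) ->
  (forall S T : {set V}, [disjoint S & T] ->
     (\sum_(x in T) r x <= \sum_(x in S) r x + \sum_(x in T) #|nbr F x :\: S|)%N) ->
  exists h : {set V} -> R,
    [/\ forall e, 0 <= h e <= 1, forall e, e \notin F -> h e = 0 &
        forall x, \sum_(e : {set V} | x \in e) h e = (r x)%:R].
Proof.
move=> F2 rP.
pose ends (p : V * V) := [set p.1; p.2].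
have [||A /subsetP AF [A1 A2]] := @bipartite_factor _ _ [set p | ends p \in F]
    (fun x => (r x)%:Z) (fun x => (r x)%:Z) => //.
  move=> X Y; rewrite !sum_Posz -PoszD lez_nat cut_nbr.
  have dXY : [disjoint Y :\: X & X :\: Y].
    by rewrite -setI_eq0; apply/eqP/setP => x; rewrite !inE;
       do 2! case: (_ \in _).
  (* The weight of [X :&: Y] cancels, leaving the hypothesis for [S := Y :\: X] and
     [T := X :\: Y]. *)
  have rX : (\sum_(x in X) r x
             = \sum_(x in X :&: Y) r x + \sum_(x in X :\: Y) r x)%N.
    exact: big_setID.
  have rY : (\sum_(y in Y) r y
             = \sum_(y in X :&: Y) r y + \sum_(y in Y :\: X) r y)%N.
    by rewrite setIC; apply: big_setID.
  by rewrite rX rY -addnA leq_add2l (leq_trans (rP _ _ dXY)) // leq_add2l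
    cut_disjoint_le.
have AF' p : p \in A -> ends p \in F by move/AF; rewrite inE.
exists (fun e => #|[set p in A | ends p == e]|%:R / 2%:R).
have fib0 e : e \notin F -> [set p in A | ends p == e] = set0.
  move=> eF; apply/setP => p; rewrite !inE; apply/negbTE.
  by apply: contra eF => /andP[/AF' pF /eqP<-].
split=> [e|e /fib0->|x]; last first.
- rewrite -mulr_suml -natr_sum.
  have -> : (\sum_(e : {set V} | x \in e) #|[set p in A | ends p == e]|
             = #|[set p in A | p.1 == x]| + #|[set p in A | p.2 == x]|)%N.
    rewrite -!sum1dep_card !big_mkcondr -big_split /=.
    under eq_bigr do rewrite -sum1dep_card.
    rewrite (exchange_big_dep (mem A)) /= => [|e p _ /andP[]//].
    apply: eq_bigr => p pA; rewrite pA /=.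
    (* The ends of [p] differ, so [p] counts once, never twice, at each of them. *)
    have := F2 _ (AF' p pA); rewrite cards2 => -[] /eqP; rewrite eqb1 => p12.
    case: (boolP (x \in ends p)) => xp.
      rewrite (big_pred1 (ends p)) => [|e]; last first.
        by apply/andP/eqP => [[_ /eqP->]|->].
      case/set2P: xp p12 => -> /negPf p12; rewrite eqxx ?p12 //.
      by rewrite eq_sym p12.
    rewrite big_pred0 => [|e].
      by move: xp; rewrite !inE negb_or ![x == _]eq_sym => /andP[/negPf-> /negPf->].
    by apply/negbTE; apply: contra xp => /andP[xe /eqP->].
  have := A1 x; have := A2 x => -[->] [->].
  by rewrite natrD -mulr2n -[X in X / _]mulr_natr mulfK ?pnatr_eq0.
- by rewrite cards0 mul0r.
rewrite divr_ge0 ?ler0n //= ler_pdivrMr ?ltr0n // mul1r ler_nat.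
have [eF|/fib0->] := boolP (e \in F); last by rewrite cards0.
have /eqP/cards2P[a [b [_ ->]]] := F2 e eF.
(* An edge has only two orientations, so [h e] is at most 1. *)
apply: (@leq_trans #|[set (a, b); (b, a)]|); last first.
  by rewrite cards2 ltnS leq_b1.
apply/subset_leq_card/subsetP => p; rewrite inE => /andP[pA /eqP pab].
have := F2 _ (AF' p pA); rewrite cards2 => -[] /eqP; rewrite eqb1.
have : p.1 \in [set a; b] by rewrite -pab set21.
have : p.2 \in [set a; b] by rewrite -pab set22.
case: p {pA pab} => c d /= /set2P[]-> /set2P[]->; rewrite ?eqxx // => _.
  exact: set22.
exact: set21.
Qed.

(** * Degrees, edge counts and the set [T] in terms of [G - E(H)] *)

Lemma deg_nbr (G : sgraph) (H : subgraph G) x :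
  deg H x = #|nbr (sub_edges H) x|.
Proof.
by apply: card_incident => e /(subsetP (sub_edges_sub H)); apply: edges_card2.
Qed.

Lemma deg_del (G : sgraph) (S : {set G}) x :
  x \notin S -> deg (del S) x = #|nbr (edges G) x :\: S|.
Proof.
move=> xS; rewrite deg_nbr; apply: eq_card => y.
by rewrite !inE subUset !sub1set !inE xS andbC.
Qed.

(** Disjointness gives each counted edge a unique orientation from [T] to [S], so edges correspond
    to ordered pairs. *)
Lemma ecount_nbr (G : sgraph) (H : subgraph G) (S T : {set G}) :
  [disjoint S & T] ->
  ecount H S T = (\sum_(x in T) #|nbr (sub_edges H) x :&: S|)%N.
Proof.
move=> dST; under eq_bigr do rewrite -sum1_card.
rewrite pair_big_dep sum1_card /ecount.
set D := (X in _ = #|X|).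
have DE x y : ((x, y) \in D)
    = [&& x \in T, [set x; y] \in sub_edges H & y \in S].
  by rewrite [LHS]unfold_in /= in_setI inE.
set C := (X in #|pred_of_set X| = _).
have -> : C = [set [set p.1; p.2] | p in D].
  apply/setP => e; rewrite /C inE; apply/andP/imsetP.
    move=> [eH /existsP[y /andP[yS /existsP[x /andP[xT /eqP exy]]]]].
    exists (x, y); last by rewrite exy setUC.
    by rewrite DE xT yS setUC -exy eH.
  move=> [[x y]]; rewrite DE => /and3P[xT xyH yS] ->.
  split=> //; apply/existsP; exists y; rewrite yS /=.
  by apply/existsP; exists x; rewrite xT setUC eqxx.
rewrite card_in_imset // => -[x y] [x' y'].
rewrite !DE => /and3P[xT _ yS] /and3P[xT' _ yS'] exy.
have xx' : x = x'.
  have : x \in [set x'; y'] by rewrite -exy set21.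
  by case/set2P => // xy; rewrite -xy (disjointFl dST xT) in yS'.
by move: exy; rewrite xx' => /set2_inj /= ->.
Qed.

Lemma ecount1_nbr (G : sgraph) (H : subgraph G) (S : {set G}) x :
  x \notin S -> ecount H [set x] S = #|nbr (sub_edges H) x :&: S|.
Proof.
move=> xS; rewrite ecount_nbr ?disjoints1 // exchange_card_nbr.
by rewrite big_set1.
Qed.

(** The neighbours of [x] in [G - S] split into those along [H] and those along [G - E(H)]; the
    former are the neighbours in [H] that avoid [S]. *)
Lemma card_nbr_del (G : sgraph) (H : subgraph G) (S : {set G}) x :
  x \notin S ->
  (deg (del S) x + #|nbr (sub_edges H) x :&: S|
   = #|nbr (edges G :\: sub_edges H) x :\: S| + deg H x)%N.
Proof.
move=> xS; rewrite deg_del // deg_nbr.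
have := cardsID (nbr (sub_edges H) x) (nbr (edges G) x :\: S).
have := cardsID S (nbr (sub_edges H) x).
have -> : (nbr (edges G) x :\: S) :&: nbr (sub_edges H) x
          = nbr (sub_edges H) x :\: S.
  apply/setP => y; rewrite !inE; case: (boolP (_ \in sub_edges H)) => xyH.
    by rewrite (subsetP (sub_edges_sub H) _ xyH) !andbT.
  by rewrite !andbF.
have -> : nbr (edges G) x :\: S :\: nbr (sub_edges H) x
          = nbr (edges G :\: sub_edges H) x :\: S.
  by apply/setP => y; rewrite !inE andbCA.
lia.
Qed.

(** By [card_nbr_del], [T] collects the vertices whose term, degree in [G - E(H) - S] minus [f x],
    is negative; hence its minimality. *)
Lemma in_Tset (G : sgraph) (f : G -> nat) (H : subgraph G) (S : {set G}) x :
  (x \in Tset f H S)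
  = (x \notin S) && (#|nbr (edges G :\: sub_edges H) x :\: S| < f x)%N.
Proof.
rewrite !inE; case: (boolP (x \in S)) => //= xS.
by have := card_nbr_del _ H _ _ xS; rewrite ecount1_nbr //; lia.
Qed.

(** Summing [card_nbr_del] over [T] absorbs both terms of [H], and the rearranged form lives in
    [nat]. *)
Lemma excluding_inequalityE (G : sgraph) (g f : G -> nat) (H : subgraph G)
    (S T : {set G}) :
  [disjoint S & T] ->
  (\sum_(x in T) (deg H x)%:Z - (ecount H S T)%:Z
   <= \sum_(x in S) (g x)%:Z + \sum_(x in T) (deg (del S) x)%:Z
      - \sum_(x in T) (f x)%:Z)
  = (\sum_(x in T) f x <= \sum_(x in S) g x
     + \sum_(x in T) #|nbr (edges G :\: sub_edges H) x :\: S|)%N.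
Proof.
move=> dST; rewrite ecount_nbr // !sum_Posz.
have : (\sum_(x in T) deg (del S) x
        + \sum_(x in T) #|nbr (sub_edges H) x :&: S|
        = \sum_(x in T) #|nbr (edges G :\: sub_edges H) x :\: S|
          + \sum_(x in T) deg H x)%N.
  rewrite -!big_split; apply: eq_bigr => x xT.
  by rewrite /= card_nbr_del // (disjointFl dST xT).
lia.
Qed.

(** * Necessity by double counting, sufficiency by [fractional_factor] *)

Theorem theorem5 (R : realType) (G : sgraph) (g f : G -> nat)
  (g_pos : forall x : G, (0 < g x)%N)
  (f_pos : forall x : G, (0 < f x)%N)
  (le_gf : forall x : G, (g x <= f x)%N)
  (H : subgraph G) :
  all_fractional_factors_excluding R g f H <->
  (forall S : {set G},
     let T := Tset f H S in
     \sum_(x in S) (g x)%:Z + \sum_(x in T) (deg (del S) x)%:Z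
       - \sum_(x in T) (f x)%:Z
     >= \sum_(x in T) (deg H x)%:Z - (ecount H S T)%:Z).
Proof.
have disT (S : {set G}) : [disjoint S & Tset f H S].
  rewrite disjoint_sym disjoints_subset; apply/subsetP => x.
  by rewrite in_Tset inE => /andP[].
have EG2 := @edges_card2 G.
set F := edges G :\: sub_edges H.
have F2 e : e \in F -> #|e| = 2%N by case/setDP => /EG2.
split=> [all S|ineq r r_pos r_gf].
  rewrite /= excluding_inequalityE ?disT // -/F; set T := Tset f H S.
  (* The extreme choice of [r]: smallest on [S], largest everywhere else. *)
  have rP x : (g x <= (if x \in S then g x else f x) <= f x)%N.
    by case: ifP; rewrite leqnn le_gf.
  have [x|h [[h01 hr] hH]] := all (fun x => if x \in S then g x else f x) _ rP.
    by case: ifP.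
  have h0 e : e \in F -> 0 <= h e <= 1 by case/setDP => /h01.
  (* Since the factor avoids [H], [h] vanishes on the edges of [H] and all its weight lies on
     [F]. *)
  have {}hr x : \sum_(y in nbr F x) h [set x; y]
                = (if x \in S then g x else f x)%:R.
    rewrite -hr -big_incident // [RHS](bigID (mem (sub_edges H))) /=.
    rewrite [X in _ = X + _]big1.
      by rewrite add0r; apply: eq_bigl => e; rewrite in_setD -andbA andbC.
    move=> e /andP[/andP[eG _] eH]; apply/eqP; move/setP/(_ e): hH.
    rewrite !inE eH eG /= lt_neqAle => /negbT; rewrite negb_and negbK.
    by have /andP[-> _] := h01 e eG; rewrite orbF eq_sym.
  rewrite -(ler_nat R) natrD !natr_sum.
  (* The weight at [T] splits: edges to [S] carry at most the weight [g] available at [S], and each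
     other edge carries at most 1. *)
  have -> : \sum_(x in T) (f x)%:R
      = \sum_(x in T) \sum_(y in nbr F x :&: S) h [set x; y]
      + \sum_(x in T) \sum_(y in nbr F x :\: S) h [set x; y] :> R.
    rewrite -big_split; apply: eq_bigr => x xT.
    by rewrite /= -big_setID hr (disjointFl (disT S) xT).
  apply: lerD.
    rewrite exchange_nbr; apply: ler_sum => y yS.
    have := hr y; rewrite yS => <-; rewrite [leRHS](big_setID T) /= lerDl.
    by apply: sumr_ge0 => x /setDP[]; rewrite inE => /h0/andP[].
  apply: ler_sum => x xT; rewrite -sum1_card natr_sum.
  by apply: ler_sum => y /setDP[]; rewrite inE => /h0/andP[].
have [|h [h01 h0 hr]] := fractional_factor R F r F2.
  move=> S T dST.
  have := ineq S; rewrite /= excluding_inequalityE ?disT // -/F => leT.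
  have leS : (\sum_(x in S) g x <= \sum_(x in S) r x)%N.
    by apply: leq_sum => x _; case/andP: (r_gf x).
  (* Minimality of [Tset f H S], vertex by vertex: with [d] the number of [F]-neighbours outside
     [S], [r x - d] is at most the positive part of [f x - d], and [Tset f H S] gathers these
     positive parts. *)
  suff : (\sum_(x in T) r x + \sum_(x in Tset f H S) #|nbr F x :\: S|
          <= \sum_(x in Tset f H S) f x + \sum_(x in T) #|nbr F x :\: S|)%N.
    lia.
  rewrite !(big_mkcond (mem T)) !(big_mkcond (mem (Tset f H S))) -!big_split /=.
  apply: leq_sum => x _; rewrite in_Tset -/F; have /andP[_ rf] := r_gf x.
  case: (boolP (x \in T)) => xT; last by case: ifP => [/andP[_ /ltnW]|]; lia.
  by rewrite (disjointFl dST xT) /=; case: ltnP; lia.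
exists h; split; first split.
- by move=> e _.
- move=> x; rewrite -hr [RHS](bigID (mem (edges G))) /= [X in _ + X]big1.
    by rewrite addr0; apply: eq_bigl => e; rewrite andbC.
  by move=> e /andP[_ eG]; rewrite h0 // inE (negPf eG) andbF.
apply/setP => e; rewrite !inE; apply/negbTE/andP => -[eH /andP[_]].
by rewrite h0 ?ltxx // inE eH.
Qed.
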